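(* Consider, for each $n$, the random-design linear model $Y_i=\mathbf{X}_i'\boldsymbol{\beta}+\varepsilon_i$, $i=1,\dots,n$, with $p_n$ covariates of which the first $k_n$ have nonzero coefficients and the others have zero coefficients, and let $\widehat{\boldsymbol{\beta}}_n$ be the LS-SCAD estimator with penalty parameters $\lambda_n>0$ and $a>2$ (all as set out in the context). Suppose that there exists an absolute constant $M_4$ such that for all $n$, $\max_{1\le j\le p_n}E[X_j^4]\le M_4<\infty$, and that: (i) $(\mathbf{X}_i',\varepsilon_i)=(X_{i1},\dots,X_{ip_n},\varepsilon_i)$, $i=1,\dots,n$, are i.i.d., distributed as $(\mathbf{X}',\varepsilon)=(X_1,\dots,X_{p_n},\varepsilon)$, with $E[X_{ij}]=0$, $\mathrm{Var}(X_{ij})=1$, $E[\varepsilon|\mathbf{X}]=0$ and $\mathrm{Var}(\varepsilon|\mathbf{X})=\sigma^2$; (ii) $\lim_{n\to\infty}p_n^2/(n\rho_1^2)=0$; (iii) $\lim_{n\to\infty}k_n\lambda_n^2/\rho_1=0$, where $\rho_1$ (which may depend on $n$) is the smallest eigenvalue of $E[\mathbf{X}\mathbf{X}']$. Then $\|\widehat{\boldsymbol{\beta}}_n-\boldsymbol{\beta}\|\to0$ in probability as $n\to\infty$.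
   Context: Setting. For each $n$, observations $(\mathbf{X}_i,Y_i)$, $i=1,\dots,n$, satisfy $Y_i=\mathbf{X}_i'\boldsymbol{\beta}+\varepsilon_i$ (the intercept is taken to be $0$), where $\mathbf{X}_i=(X_{i1},\dots,X_{ip_n})'$ is a random $p_n\times1$ vector, $\varepsilon_i$ is a random error, and $\boldsymbol{\beta}=(\beta_1,\dots,\beta_{p_n})'\in\mathbb{R}^{p_n}$ is nonrandom. The covariates and their law, and the parameters $p_n,k_n,\boldsymbol{\beta},\lambda_n$ may depend on $n$; $a>2$ and $\sigma^2$ are fixed. Write $\boldsymbol{\beta}=(\boldsymbol{\beta}_1',\boldsymbol{\beta}_2')'$ with $\boldsymbol{\beta}_1=(\beta_1,\dots,\beta_{k_n})'$ having all components nonzero and $\boldsymbol{\beta}_2=\mathbf{0}_{m_n}$, $m_n=p_n-k_n$. Let $\mathbf{Y}=(Y_1,\dots,Y_n)'$ and let $\mathbb{X}=(X_{ij})$ be the $n\times p_n$ design matrix. $\|\cdot\|$ is the Euclidean norm. Conditions with $\rho_1$ in a denominator are understood with $\rho_1>0$. SCAD penalty. For $a>2$, $\lambda>0$: $p_\lambda(\theta;a)=\lambda|\theta|$ if $|\theta|\le\lambda$; $p_\lambda(\theta;a)=-(\theta^2-2a\lambda|\theta|+\lambda^2)/[2(a-1)]$ if $\lambda<|\theta|\le a\lambda$; $p_\lambda(\theta;a)=(a+1)\lambda^2/2$ if $|\theta|>a\lambda$. LS-SCAD estimator. $\widehat{\boldsymbol{\beta}}_n=\arg\min_{\mathbf{b}\in\mathbb{R}^{p_n}}Q_n(\mathbf{b};\lambda_n,a)$,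 where $Q_n(\mathbf{b};\lambda_n,a)=\|\mathbf{Y}-\mathbb{X}\mathbf{b}\|^2+n\sum_{j=1}^{p_n}p_{\lambda_n}(b_j;a)$ (a global minimizer). *)

(* Defs.v *)
From HB Require Import structures.
From mathcomp Require Export all_boot all_order all_algebra.
From mathcomp Require Export all_classical all_reals all_analysis.
Set Implicit Arguments.
Unset Strict Implicit.
Unset Printing Implicit Defensive.
Import Order.TTheory GRing.Theory Num.Theory.
Import numFieldNormedType.Exports.
Local Open Scope classical_set_scope.
Local Open Scope ring_scope.

(* The norm MathComp-Analysis puts on matrices is the sup norm, hence this one. *)
Definition enorm (R : realType) (m : nat) (v : 'cV[R]_m) : R :=
  Num.sqrt (\sum_(i < m) v i 0 ^+ 2).

Definition scad (R : realType) (lambda a theta : R) : R :=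
  if `|theta| <= lambda then lambda * `|theta|
  else if `|theta| <= a * lambda then
    - ((theta ^+ 2 - 2 * a * lambda * `|theta| + lambda ^+ 2)
         / (2 * (a - 1)))
  else (a + 1) * lambda ^+ 2 / 2.

Definition ls_scad (R : realType) (n p : nat) (lambda a : R)
    (y : 'cV[R]_n) (x : 'M[R]_(n, p)) (b : 'cV[R]_p) : R :=
  enorm (y - x *m b) ^+ 2 + n%:R * \sum_(j < p) scad lambda a (b j 0).

Definition is_global_minimizer (R : realType) (U : Type) (f : U -> R) (u : U) :
  Prop := forall v : U, f u <= f v.

Definition is_smallest_eigenvalue (R : realType) (m : nat) (A : 'M[R]_m)
    (r : R) : Prop :=
  eigenvalue A r /\ forall s : R, eigenvalue A s -> r <= s.

Section random_vectors.
Context (R : realType) (d : measure_display) (T : measurableType d).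
Variable P : probability T R.

(* The matrix E[X X']; its entries are finite as soon as the coordinates of X
   are square integrable, so that [fine] discards nothing. *)
Definition second_moment_mx (p : nat) (X : T -> p.-tuple R) : 'M[R]_p :=
  \matrix_(i < p, j < p) fine 'E_P[fun w => (tnth (X w) i * tnth (X w) j)%R].

Definition design_mx (n p : nat) (X : 'I_n -> T -> p.-tuple R) (w : T) :
  'M[R]_(n, p) := \matrix_(i < n, j < p) tnth (X i w) j.

Definition mutually_independent (I : finType) (d' : measure_display)
    (E : measurableType d') (Z : I -> T -> E) : Prop :=
  forall (J : {set I}) (B : I -> set E),
    (forall i, i \in J -> measurable (B i)) ->
    P (\bigcap_(i in [set` J]) (Z i @^-1` B i)) =
      (\prod_(i in J) fine (P (Z i @^-1` B i)))%:E.

Definition same_distribution (d' : measure_display) (E : measurableType d')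
    (Z Z' : T -> E) : Prop :=
  forall B : set E, measurable B -> P (Z @^-1` B) = P (Z' @^-1` B).

Definition generated_sigma_algebra (d' : measure_display)
    (E : measurableType d') (Z : T -> E) : set_system T :=
  preimage_set_system setT Z measurable.

(* W is a version of E[V | G], for a sub-sigma-algebra G. *)
Definition is_cond_expectation (G : set_system T) (V W : T -> R) : Prop :=
  [/\ P.-integrable setT (EFin \o V),
      P.-integrable setT (EFin \o W),
      (forall B : set R, measurable B -> G (W @^-1` B))
    & forall A : set T, G A ->
        (\int[P]_(w in A) (V w)%:E = \int[P]_(w in A) (W w)%:E)%E].

(* W is a version of Var(V | G) = E[(V - E[V | G])^2 | G]. *)
Definition is_cond_variance (G : set_system T) (V W : T -> R) : Prop :=
  exists M : T -> R, is_cond_expectation G V M /\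
    is_cond_expectation G (fun w => (V w - M w) ^+ 2) W.

End random_vectors.

(* Main.v *)
(* Write [d] for the estimation error. Comparing the objective at the minimizer
   and at [beta], and bounding the penalty of each of the [k] nonzero
   coefficients by its maximum [(a + 1) lambda^2 / 2], gives
     |X d|^2 <= 2 <X' eps, d> + n k (a + 1) lambda^2 / 2.
   If the Gram matrix [X'X / n] is within [rho1 / 2] of its mean in Frobenius
   norm, then [|X d|^2 >= (n rho1 / 2) |d|^2]; so an error larger than [e]
   forces, once [k lambda^2 / rho1] is small, either a large Frobenius deviation
   or a large score [X' eps]. Second moments bound the probability of both by a
   multiple of [p^2 / (n rho1^2)]. *)
Require Import Defs.
From mathcomp Require Import finmap measurable_realfun ring lra.
Set Implicit Arguments.
Unset Strict Implicit.
Unset Printing Implicit Defensive.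
Import Order.TTheory GRing.Theory Num.Theory.
Import numFieldNormedType.Exports.
Import HBNNSimple.
Local Open Scope classical_set_scope.
Local Open Scope ring_scope.

(** * Deterministic bounds *)

(** With fourth moments only, the Gram deviation is controlled entry by entry: each of the [p^2]
    entries of [X'X - n E[X X']] is a sum of [n] centered i.i.d. terms of bounded variance, so the
    expected squared Frobenius norm is of order [n p^2]. Against a squared threshold of order
    [(n rho1)^2] this leaves [p^2 / (n rho1^2)], the quantity of condition (ii). The score has only
    [p] coordinates and costs [p / (n rho1^2)].

    On the probabilistic side the obstacle is that independence and conditional moments are given
    through events, while the second-moment computations need integrals of products. One principle
    bridges the gap, [integral_mul_eq0]: if [U] integrates to 0 over every event generated by [h],
    then [U h] has integral 0. It yields the orthogonality of distinct observations, the centering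
    of [X_j eps], and the almost sure vanishing of the conditional mean hidden in the definition of
    conditional variance. *)

Lemma cauchy_schwarz_sum (R : realType) (I : finType) (u v : I -> R) :
  (\sum_i u i * v i) ^+ 2 <= (\sum_i u i ^+ 2) * (\sum_i v i ^+ 2).
Proof.
(* Lagrange's identity: this double sum is twice the gap between the two sides. *)
have H : 0 <= \sum_i \sum_j (u i * v j - u j * v i) ^+ 2.
  by apply: sumr_ge0 => i _; apply: sumr_ge0 => j _; exact: sqr_ge0.
have E : \sum_i \sum_j (u i * v j - u j * v i) ^+ 2 =
    2 * ((\sum_i u i ^+ 2) * (\sum_i v i ^+ 2)) - 2 * (\sum_i u i * v i) ^+ 2.
  have -> : (\sum_i u i ^+ 2) * (\sum_i v i ^+ 2) =
      \sum_i \sum_j u i ^+ 2 * v j ^+ 2.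
    by rewrite mulr_suml; apply: eq_bigr => i _; rewrite mulr_sumr.
  have -> : (\sum_i u i * v i) ^+ 2 = \sum_i \sum_j (u i * v i) * (u j * v j).
    by rewrite expr2 mulr_suml; apply: eq_bigr => i _; rewrite mulr_sumr.
  have -> : 2 * (\sum_i \sum_j u i ^+ 2 * v j ^+ 2) =
      \sum_i \sum_j u i ^+ 2 * v j ^+ 2 + \sum_i \sum_j u j ^+ 2 * v i ^+ 2.
    by rewrite [X in _ + X]exchange_big/= mulr2n mulrDl mul1r.
  rewrite mulr_sumr -big_split -sumrB; apply: eq_bigr => i _ /=.
  rewrite mulr_sumr -big_split -sumrB; apply: eq_bigr => j _ /=; ring.
by move: H; rewrite E subr_ge0 ler_pM2l.
Qed.

(** The upper bound is the plateau value; the middle branch falls short of it by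
    [(|t| - a * lambda)^2 / (2 * (a - 1))]. *)
Lemma scad_bounds (R : realType) (lambda a t : R) : 2 < a -> 0 < lambda ->
  0 <= scad lambda a t <= (a + 1) * lambda ^+ 2 / 2.
Proof.
move=> a2 l0; rewrite /scad.
have t0 := normr_ge0 t.
rewrite -(real_normK (num_real t)).
move: `|t| t0 => s s0.
case: ifPn => [sl|]; first by apply/andP; split; nra.
rewrite -ltNge => ls; case: ifPn => [sal|_]; last by apply/andP; split; nra.
rewrite -mulNr; have a1 : 0 < 2 * (a - 1) by lra.
by rewrite ler_pdivrMr// divr_ge0 ?(ltW a1)//; nra.
Qed.

Lemma scad0 (R : realType) (lambda a : R) : 0 < lambda -> scad lambda a 0 = 0.
Proof. by move=> l0; rewrite /scad normr0 (ltW l0) mulr0. Qed.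

Lemma enorm_sqr (R : realType) (m : nat) (v : 'cV[R]_m) :
  enorm v ^+ 2 = \sum_(i < m) v i 0 ^+ 2.
Proof. by rewrite sqr_sqrtr// sumr_ge0// => i _; exact: sqr_ge0. Qed.

(** * Variational bound for the smallest eigenvalue *)

Section rayleigh.
Context (R : realType) (m : nat).
Implicit Types (A : 'M[R]_m) (u v : 'rV[R]_m).

Let qf A u : R := (u *m A *m u^T) 0 0.

Let sqn u : R := \sum_i u 0 i ^+ 2.

Let sqn_ge0 u : 0 <= sqn u.
Proof. by apply: sumr_ge0 => i _; exact: sqr_ge0. Qed.

Let sqn_eq0 u : sqn u = 0 -> u = 0.
Proof.
move=> /eqP; rewrite psumr_eq0; last by move=> i _; exact: sqr_ge0.
by move=> /allP u0; apply/rowP => i; rewrite mxE; apply/eqP;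
  rewrite -sqrf_eq0; exact: (u0 i (mem_index_enum _)).
Qed.

Let sqnE u : sqn u = (u *m u^T) 0 0.
Proof. by rewrite mxE; apply: eq_bigr => i _; rewrite mxE expr2. Qed.

Let sqnZ c u : sqn (c *: u) = c ^+ 2 * sqn u.
Proof. by rewrite /sqn mulr_sumr; apply: eq_bigr => i _; rewrite mxE exprMn. Qed.

Let qfZ A c u : qf A (c *: u) = c ^+ 2 * qf A u.
Proof. by rewrite /qf linearZ/= -!scalemxAl -scalemxAr !mxE mulrA expr2. Qed.

Let continuous_sqn : continuous sqn.
Proof.
apply: (@continuous_big _ _ +%R 0 xpredT add_continuous 'rV[R]_m _
  (fun i u => u 0 i ^+ 2)) => i _ u.
apply: (@continuous_comp _ _ _ (fun u : 'rV[R]_m => u 0 i) (fun x => x ^+ 2)).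
  exact: coord_continuous.
exact: exprn_continuous.
Qed.

Let continuous_qf A : continuous (qf A).
Proof.
have -> : qf A = fun u => \sum_j (\sum_i u 0 i * A i j) * u 0 j.
  by apply/funext => u; rewrite /qf mxE; apply: eq_bigr => j _; rewrite !mxE.
have cvA j : continuous (fun u => \sum_i u 0 i * A i j).
  apply: (@continuous_big _ _ +%R 0 xpredT add_continuous 'rV[R]_m _
    (fun i u => u 0 i * A i j)) => i _ u.
  by apply: continuousM; [exact: coord_continuous|exact: cst_continuous].
apply: (@continuous_big _ _ +%R 0 xpredT add_continuous 'rV[R]_m _
  (fun j u => (\sum_i u 0 i * A i j) * u 0 j)) => j _ u.
by apply: continuousM; [exact: cvA|exact: coord_continuous].
Qed.

(** A variational argument in place of diagonalization: the form attains a minimum [mu] on the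
    compact unit sphere, [mu] is itself an eigenvalue, hence [r <= mu], and homogeneity extends the
    bound from the sphere to all vectors. Row vectors fit the left eigenvectors of [eigenvalue]. *)
Lemma rayleigh_le A r : A^T = A -> is_smallest_eigenvalue A r ->
  forall u, r * sqn u <= qf A u.
Proof.
move=> symA [/eigenvalueP[w wA w0] rmin].
pose S := [set u | sqn u = 1].
have S0 : S !=set0.
  have sw : 0 < sqn w.
    by rewrite lt_neqAle sqn_ge0 andbT eq_sym; apply: contra_neq w0 => /sqn_eq0.
  exists ((Num.sqrt (sqn w))^-1 *: w).
  by rewrite /S/= sqnZ exprVn sqr_sqrtr ?ltW// mulVf// gt_eqF.
have cS : compact S.
  have segc : compact [set v : 'rV[R]_m | forall i, v ord0 i \in `[-1, 1]].
    apply: (@rV_compact R _ (fun=> `[-1, 1]%classic)) => _.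
    exact: segment_compact.
  apply: subclosed_compact segc _.
    rewrite (_ : S = sqn @^-1` [set x | x = 1])//.
    by apply: preimage_closed; [move=> u _; exact: continuous_sqn|exact: closed_eq].
  move=> u /= Su i; rewrite in_itv/= -ler_norml -(@expr_le1 _ 2)//.
  rewrite real_normK ?num_real//.
  by rewrite -Su /sqn (bigD1 i)//= lerDl sumr_ge0// => j _; exact: sqr_ge0.
have [v /set_mem Sv vmin] := EVT_min_rV S0 cS
  (continuous_subspaceT (@continuous_qf A)).
have psd u : qf A v * sqn u <= qf A u.
  have [->|u0] := eqVneq u 0.
    by rewrite sqnE /qf !mul0mx !mxE mulr0.
  have su : 0 < sqn u.
    by rewrite lt_neqAle sqn_ge0 andbT eq_sym; apply: contra_neq u0 => /sqn_eq0.
  rewrite -ler_pdivlMr// mulrC.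
  have -> : (sqn u)^-1 * qf A u = qf A ((Num.sqrt (sqn u))^-1 *: u).
    by rewrite qfZ exprVn sqr_sqrtr ?ltW.
  apply: vmin; apply/mem_set.
  by rewrite /S/= sqnZ exprVn sqr_sqrtr ?ltW// mulVf// gt_eqF.
pose mu := qf A v; pose B := A - mu%:M.
have qfB u : qf B u = qf A u - mu * sqn u.
  rewrite sqnE /qf mulmxBr mulmxBl mul_mx_scalar -scalemxAl.
  by rewrite !mxE.
have symB : B^T = B by rewrite /B linearB/= tr_scalar_mx symA.
pose bf (x y : 'rV[R]_m) : R := (x *m B *m y^T) 0 0.
have bfC x y : bf x y = bf y x.
  have -> : bf y x = (y *m B *m x^T)^T 0 0 by rewrite [RHS]mxE.
  by rewrite !trmx_mul trmxK symB mulmxA.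
have bfDl x y z c : bf (x + c *: y) z = bf x z + c * bf y z.
  by rewrite /bf !mulmxDl -!scalemxAl [LHS]mxE [X in _ + X]mxE.
(* Perturbing the minimizer [v] in the direction [v *m B] shows that [v] is an
   eigenvector for the minimal value. *)
have vB : v *m B = 0.
  apply: sqn_eq0; set u := v *m B.
  have vBu : bf v u = sqn u by rewrite sqnE.
  have q0 : 0 <= qf B u by rewrite qfB subr_ge0.
  have bil (t : R) : 0 <= 2 * t * sqn u + t ^+ 2 * qf B u.
    suff -> : 2 * t * sqn u + t ^+ 2 * qf B u = qf B (v + t *: u).
      by rewrite qfB subr_ge0.
    have qvB : qf B v = 0 by rewrite qfB Sv mulr1 subrr.
    have qfE x : qf B x = bf x x by [].
    rewrite !qfE bfDl (bfC v) (bfC u) !bfDl (bfC u v) -(qfE v) qvB vBu; ring.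
  have s0 := sqn_ge0 u.
  have t0 : 0 < (qf B u + 1)^-1 by rewrite invr_gt0; lra.
  have e1 : qf B u * (qf B u + 1)^-1 = 1 - (qf B u + 1)^-1.
    by rewrite -[X in _ = X - _](@divff _ (qf B u + 1)) ?gt_eqF//; [ring|lra].
  (* The quadratic in [t] is smallest at [- sqn u / qf B u]; the [+ 1] in the denominator covers the
     case [qf B u = 0]. With [tau = (qf B u + 1)^-1] the value at this point is
     [- sqn u ^ 2 * tau * (1 + tau)], which is negative unless [u = 0]. *)
  have := bil (- (sqn u * (qf B u + 1)^-1)).
  move: (qf B u) q0 (_^-1) t0 e1 => q q0 t t0 e1 H.
  have {}H : 0 <= - (sqn u ^+ 2) * t * (1 + t).
    suff <- : - (sqn u ^+ 2) * t * 2 + sqn u ^+ 2 * t * (q * t) =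
        - (sqn u ^+ 2) * t * (1 + t) by apply: le_trans H _; nra.
    by rewrite e1; ring.
  apply/eqP; rewrite -sqrf_eq0 eq_le sqr_ge0 andbT.
  rewrite -oppr_ge0 -(pmulr_lge0 _ (_ : 0 < t * (1 + t))) ?mulr_gt0//; last lra.
  by rewrite mulrA.
have : r <= mu.
  apply: rmin; apply/eigenvalueP; exists v; last first.
    apply/eqP => v0; move: Sv; rewrite /S/= v0 sqnE mul0mx mxE => /eqP.
    by rewrite eq_sym oner_eq0.
  by apply/eqP; rewrite -subr_eq0 -mul_mx_scalar -mulmxBr vB.
by move=> rmu u; apply: le_trans (psd u); exact: ler_wpM2r.
Qed.
End rayleigh.

Lemma smallest_eigenvalue_le (R : realType) (m : nat) (A : 'M[R]_m) (r : R) :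
  A^T = A -> is_smallest_eigenvalue A r -> forall v : 'cV[R]_m,
  r * (\sum_i v i 0 ^+ 2) <= \sum_i \sum_j v i 0 * v j 0 * A i j.
Proof.
move=> symA rA v; have := rayleigh_le symA rA v^T.
under eq_bigr do rewrite mxE.
suff -> : (v^T *m A *m v^T^T) 0 0 = \sum_i \sum_j v i 0 * v j 0 * A i j by [].
rewrite trmxK mxE exchange_big; apply: eq_bigr => j _ /=.
rewrite mxE mulr_suml; apply: eq_bigr => i _; rewrite mxE; ring.
Qed.

Lemma ls_scad_basic_inequality (R : realType) (n p k : nat) (lambda a : R)
    (x : 'M[R]_(n, p)) (z : 'cV[R]_n) (b beta : 'cV[R]_p) :
  2 < a -> 0 < lambda -> (k <= p)%N ->
  (forall j : 'I_p, (k <= j)%N -> beta j 0 = 0) ->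
  ls_scad lambda a (x *m beta + z) x b <=
    ls_scad lambda a (x *m beta + z) x beta ->
  \sum_i (x *m (b - beta)) i 0 ^+ 2 <=
    2 * (\sum_i z i 0 * (x *m (b - beta)) i 0) +
    n%:R * (k%:R * ((a + 1) * lambda ^+ 2 / 2)).
Proof.
move=> a2 l0 kp beta0; rewrite /ls_scad.
have -> : x *m beta + z - x *m beta = z by rewrite addrAC subrr add0r.
have -> : x *m beta + z - x *m b = z - x *m (b - beta).
  by rewrite mulmxBr opprB addrA [z + _]addrC.
set w := x *m (b - beta); rewrite !enorm_sqr.
have -> : \sum_i (z - w) i 0 ^+ 2 =
    \sum_i z i 0 ^+ 2 - 2 * (\sum_i z i 0 * w i 0) + \sum_i w i 0 ^+ 2.
  rewrite mulr_sumr -sumrB -big_split; apply: eq_bigr => i _ /=.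
  rewrite !mxE; ring.
have pb : 0 <= n%:R * \sum_(j < p) scad lambda a (b j 0).
  rewrite mulr_ge0// sumr_ge0// => j _.
  by have /andP[] := scad_bounds (b j 0) a2 l0.
have pbeta : n%:R * \sum_(j < p) scad lambda a (beta j 0) <=
    n%:R * (k%:R * ((a + 1) * lambda ^+ 2 / 2)).
  rewrite ler_wpM2l// (bigID (fun j : 'I_p => (j < k)%N))/=.
  rewrite [X in _ + X]big1 ?addr0; last first.
    by move=> j; rewrite -leqNgt => kj; rewrite beta0// scad0.
  apply: (@le_trans _ _ (\sum_(j < p | (j < k)%N) ((a + 1) * lambda ^+ 2 / 2))).
    by apply: ler_sum => j _; have /andP[] := scad_bounds (beta j 0) a2 l0.
  by rewrite -(big_ord_widen p (fun=> _) kp) sumr_const card_ord mulr_natl.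
lra.
Qed.

(** The constants are tuned to one factorization. Put [s = |b - beta|]. If both deviations stay
    below their thresholds, the quadratic term is at least [n rho s^2 / 2], the cross term at most
    [n rho e s / 4] and the penalty term at most [n rho e^2 / 4]. The basic inequality then reads
    [(s - e) (2 s + e) <= 0], which contradicts [e < s]. *)
Lemma ls_scad_error (R : realType) (n p k : nat) (lambda a rho e : R)
    (x : 'M[R]_(n, p)) (z : 'cV[R]_n) (b beta : 'cV[R]_p) (S : 'M[R]_p) :
  2 < a -> 0 < lambda -> (0 < n)%N -> (k <= p)%N ->
  (forall j : 'I_p, (k <= j)%N -> beta j 0 = 0) ->
  ls_scad lambda a (x *m beta + z) x b <=
    ls_scad lambda a (x *m beta + z) x beta ->
  0 < rho -> 0 < e ->
  (forall v : 'cV[R]_p,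
     rho * (\sum_i v i 0 ^+ 2) <= \sum_i \sum_j v i 0 * v j 0 * S i j) ->
  2 * (a + 1) * (k%:R * lambda ^+ 2 / rho) <= e ^+ 2 ->
  e < enorm (b - beta) ->
  (n%:R * rho / 2) ^+ 2 <
    \sum_j \sum_l (\sum_i (x i j * x i l - S j l)) ^+ 2 \/
  (n%:R * rho * e / 8) ^+ 2 < \sum_j (\sum_i x i j * z i 0) ^+ 2.
Proof.
move=> a2 l0 n0 kp beta0 mini rho0 e0 rhoS small eb.
have {mini} := ls_scad_basic_inequality a2 l0 kp beta0 mini.
move: (b - beta) eb => v.
set N := \sum_i v i 0 ^+ 2 => eb.
have eN : e ^+ 2 < N.
  by rewrite /N -enorm_sqr ltr_pXn2r ?nnegrE//; [exact: ltW|exact: sqrtr_ge0].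
set c := n%:R * _ => basic.
have n0' : 0 < n%:R :> R by rewrite ltr0n.
case: (ltP ((n%:R * rho / 2) ^+ 2)
  (\sum_j \sum_l (\sum_i (x i j * x i l - S j l)) ^+ 2)) => [|hD]; first by left.
case: (ltP ((n%:R * rho * e / 8) ^+ 2)
  (\sum_j (\sum_i x i j * z i 0) ^+ 2)) => [|hG]; first by right.
exfalso.
set D := fun j l => \sum_i (x i j * x i l - S j l) in hD.
set G := fun j => \sum_i x i j * z i 0 in hG.
have crossE : \sum_i z i 0 * (x *m v) i 0 = \sum_j v j 0 * G j.
  under [RHS]eq_bigr do rewrite mulr_sumr.
  rewrite exchange_big; apply: eq_bigr => i _ /=.
  rewrite mxE mulr_sumr; apply: eq_bigr => j _; ring.
(* [D] holds the entries of [X'X - n S], unnormalized, so [|X v|^2] splits into the deviation form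
   and [n] times the population form. *)
have quadE : \sum_i (x *m v) i 0 ^+ 2 = \sum_j \sum_l v j 0 * v l 0 * D j l +
    n%:R * \sum_j \sum_l v j 0 * v l 0 * S j l.
  rewrite mulr_sumr -big_split/=.
  under [RHS]eq_bigr do rewrite mulr_sumr -big_split/=.
  have -> : \sum_i (x *m v) i 0 ^+ 2 =
      \sum_i \sum_j \sum_l v j 0 * v l 0 * (x i j * x i l).
    apply: eq_bigr => i _; rewrite mxE expr2 mulr_suml; apply: eq_bigr => j _.
    rewrite mulr_sumr; apply: eq_bigr => l _; ring.
  rewrite exchange_big; apply: eq_bigr => j _ /=.
  rewrite exchange_big; apply: eq_bigr => l _ /=.
  rewrite -mulr_sumr /D sumrB sumr_const card_ord -[S j l *+ n]mulr_natl; ring.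
have cG : (\sum_j v j 0 * G j) ^+ 2 <= N * (n%:R * rho * e / 8) ^+ 2.
  apply: le_trans (cauchy_schwarz_sum _ _) _.
  by rewrite ler_wpM2l// sumr_ge0// => j _; exact: sqr_ge0.
(* Cauchy-Schwarz over pairs of indices: the Frobenius norm of the rank-one matrix [v v'] is
   [|v|^2], so a quadratic form is at most [|v|^2] times the Frobenius norm of its matrix. *)
have cD : (\sum_j \sum_l v j 0 * v l 0 * D j l) ^+ 2 <=
    N ^+ 2 * (n%:R * rho / 2) ^+ 2.
  rewrite pair_bigA; apply: le_trans (cauchy_schwarz_sum _ _) _ => /=.
  rewrite -(pair_bigA _ (fun j l => D j l ^+ 2))/=.
  rewrite -(pair_bigA _ (fun j l => (v j 0 * v l 0) ^+ 2))/=.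
  suff -> : \sum_i \sum_j (v i 0 * v j 0) ^+ 2 = N ^+ 2.
    by rewrite ler_wpM2l// sqr_ge0.
  rewrite expr2 mulr_suml; apply: eq_bigr => j _.
  by rewrite mulr_sumr; apply: eq_bigr => l _; rewrite exprMn.
have N0 : 0 < N by apply: lt_trans eN; rewrite exprn_gt0.
pose s := Num.sqrt N.
have s0 : 0 < s by rewrite sqrtr_gt0.
have sN : N = s ^+ 2 by rewrite sqr_sqrtr// ltW.
have es : e < s by rewrite -(ltr_pXn2r (n := 2)) ?nnegrE ?ltW// -sN.
have {}cG : \sum_j v j 0 * G j <= s * (n%:R * rho * e / 8).
  apply: le_trans (ler_norm _) _.
  rewrite -(ler_pXn2r (n := 2)) ?nnegrE//; last first.
    by rewrite mulr_ge0 ?ltW// !mulr_gt0// invr_gt0.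
  by rewrite real_normK ?num_real// exprMn -sN.
have {}cD : - (\sum_j \sum_l v j 0 * v l 0 * D j l) <= N * (n%:R * rho / 2).
  apply: le_trans (ler_norm _) _; rewrite normrN.
  rewrite -(ler_pXn2r (n := 2)) ?nnegrE//; last first.
    by rewrite mulr_ge0 ?ltW// !mulr_gt0// invr_gt0.
  by rewrite real_normK ?num_real// exprMn.
have qS := rhoS v; rewrite -/N in qS.
have nqS : n%:R * (rho * N) <= n%:R * \sum_j \sum_l v j 0 * v l 0 * S j l.
  by rewrite ler_pM2l.
rewrite quadE crossE in basic.
have cE : c <= n%:R * (rho * e ^+ 2) / 4.
  have -> : c = n%:R * (rho * (2 * (a + 1) * (k%:R * lambda ^+ 2 / rho))) / 4.
    by rewrite /c; field; rewrite gt_eqF.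
  by rewrite ler_pM2r ?invr_gt0// !ler_pM2l.
have nr0 : 0 < n%:R * rho by rewrite mulr_gt0.
rewrite sN in cD nqS.
have : n%:R * rho * s ^+ 2 / 2 <=
    2 * (s * (n%:R * rho * e / 8)) + n%:R * (rho * e ^+ 2) / 4.
  lra.
have : n%:R * rho * s ^+ 2 / 2 - 2 * (s * (n%:R * rho * e / 8)) -
    n%:R * (rho * e ^+ 2) / 4 =
  n%:R * rho * ((s - e) * (2 * s + e)) / 4 by field.
have : 0 < n%:R * rho * ((s - e) * (2 * s + e)).
  by rewrite !mulr_gt0//; lra.
lra.
Qed.

(** * Orthogonality and independence *)

Section integral_mul.
Local Open Scope ereal_scope.
Context d (T : measurableType d) (R : realType) (mu : {measure set T -> \bar R}).
Implicit Types u v h : T -> R.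

Let integral_mul_nnsfun u h (s : {nnsfun R >-> R}) :
  measurable_fun setT u -> measurable_fun setT h -> (forall w, 0 <= u w)%R ->
  \int[mu]_w (u w * s (h w))%:E =
  \sum_(i < #|` fset_set (range s)|) (((fset_set (range s))`_i)%:E *
    \int[mu]_(w in h @^-1` (s @^-1` [set (fset_set (range s))`_i])) (u w)%:E).
Proof.
move=> mu' mh u0.
have y0 (i : 'I_#|` fset_set (range s)|) : (0 <= (fset_set (range s))`_i)%R.
  have : (fset_set (range s))`_i \in fset_set (range s) by rewrite mem_nth.
  by rewrite in_fset_set// => /set_mem[x _ <-].
have mB y : measurable (h @^-1` (s @^-1` [set y])).
  by rewrite -[X in measurable X]setTI; exact: mh.
under eq_integral => w _ do rewrite fimfunEord mulr_sumr -sumEFin.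
rewrite ge0_integral_sum//=; last 2 first.
- move=> i; apply/measurable_EFinP; apply: measurable_funM => //.
  by apply: measurable_funM => //; exact: measurableT_comp.
- by move=> i w _; rewrite lee_fin !mulr_ge0.
apply: eq_bigr => i _; rewrite -ge0_integralZl_EFin//; last first.
- exact/measurable_funTS/measurable_EFinP.
- by move=> w _; rewrite lee_fin.
rewrite [RHS]integral_mkcond; apply: eq_integral => w _.
rewrite patchE indicE.
rewrite (_ : (h w \in _) =
  (w \in h @^-1` (s @^-1` [set (fset_set (range s))`_i]))); last by [].
case: ifP => _; last by rewrite !mulr0.
by rewrite mulr1 mulrC EFinM.
Qed.

(** The hypothesis is the case where the factor [h] is replaced by an indicator of an event
    generated by [h]. Linearity extends it to simple functions of [h], and monotone convergence to
    [h] itself. *)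
Lemma ge0_integral_mul_eq u v h :
  measurable_fun setT u -> measurable_fun setT v -> measurable_fun setT h ->
  (forall w, 0 <= u w)%R -> (forall w, 0 <= v w)%R -> (forall w, 0 <= h w)%R ->
  (forall B, measurable B ->
    \int[mu]_(w in h @^-1` B) (u w)%:E = \int[mu]_(w in h @^-1` B) (v w)%:E) ->
  \int[mu]_w (u w * h w)%:E = \int[mu]_w (v w * h w)%:E.
Proof.
move=> mu' mv mh u0 v0 h0 uv.
(* The simple functions approximate the absolute value on the real line and are then composed with
   [h], rather than approximating [h] on [T]: their level sets are thus preimages under [h], where
   the hypothesis applies. *)
have mf : measurable_fun setT (fun y : R => `|y|%:E) by exact/measurable_EFinP.
pose s := nnsfun_approx measurableT mf.
have lims (k : T -> R) : measurable_fun setT k -> (forall w, 0 <= k w)%R ->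
    \int[mu]_w (k w * h w)%:E =
    limn (fun n => \int[mu]_w (k w * s n (h w))%:E).
  move=> mk k0; rewrite -monotone_convergence//.
  - apply: eq_integral => w _; apply/esym/cvg_lim => //.
    under eq_fun do rewrite EFinM.
    rewrite EFinM; apply: cvgeZl => //.
    have -> : (h w)%:E = `|h w|%:E by rewrite ger0_norm.
    exact: cvg_nnsfun_approx.
  - move=> n; apply/measurable_EFinP; apply: measurable_funM => //.
    exact: measurableT_comp.
  - by move=> n w _; rewrite lee_fin mulr_ge0.
  - move=> w _ m n mn; rewrite lee_fin ler_wpM2l//.
    exact/lefP/nd_nnsfun_approx.
rewrite !lims//; congr (limn _); apply/funext => n.
rewrite !integral_mul_nnsfun//; apply: eq_bigr => i _.
by rewrite uv//; rewrite -[X in measurable X]setTI; exact: measurable_funPT.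
Qed.

End integral_mul.

(** Expresses the positive part of a product through the positive and negative parts of its factors;
    applied to [- a] it also gives the negative part. *)
Lemma max0M (R : realType) (a b : R) : Num.max (a * b) 0 =
  Num.max a 0 * Num.max b 0 + Num.max (- a) 0 * Num.max (- b) 0.
Proof.
have ge0E (x : R) : 0 <= x -> Num.max x 0 = x /\ Num.max (- x) 0 = 0.
  by move=> x0; rewrite max_l// max_r// oppr_le0.
have le0E (x : R) : x <= 0 -> Num.max x 0 = 0 /\ Num.max (- x) 0 = - x.
  by move=> x0; rewrite max_r// max_l// oppr_ge0.
have /orP[a0|a0] := le_total 0 a; have /orP[b0|b0] := le_total 0 b.
- have [-> ->] := ge0E _ a0; have [-> ->] := ge0E _ b0.
  by rewrite max_l ?mulr_ge0// mulr0 addr0.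
- have [-> ->] := ge0E _ a0; have [-> ->] := le0E _ b0.
  by rewrite max_r ?mulr_ge0_le0// mulr0 mul0r addr0.
- have [-> ->] := le0E _ a0; have [-> ->] := ge0E _ b0.
  by rewrite max_r ?mulr_le0_ge0// mulr0 mul0r addr0.
- have [-> ->] := le0E _ a0; have [-> ->] := le0E _ b0.
  by rewrite max_l ?mulr_le0// mul0r mulrNN add0r.
Qed.

Section integral_mul_eq0.
Local Open Scope ereal_scope.
Context d (T : measurableType d) (R : realType) (mu : {measure set T -> \bar R}).
Implicit Types U h : T -> R.

Let pos U w := Num.max (U w) 0%R.
Let neg U w := Num.max (- U w)%R 0%R.

Let pos_ge0 U w : (0 <= pos U w)%R. Proof. by rewrite le_max lexx orbT. Qed.
Let neg_ge0 U w : (0 <= neg U w)%R. Proof. by rewrite le_max lexx orbT. Qed.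

Let measurable_pos U : measurable_fun setT U -> measurable_fun setT (pos U).
Proof. by move=> mU; exact: measurable_maxr. Qed.

Let measurable_neg U : measurable_fun setT U -> measurable_fun setT (neg U).
Proof. by move=> mU; apply: measurable_maxr => //; exact: measurableT_comp. Qed.

Let funepos_pos U : (EFin \o U)^\+ = (fun w => (pos U w)%:E).
Proof. by apply/funext => w; rewrite funeposE/= EFin_max. Qed.

Let funeneg_neg U : (EFin \o U)^\- = (fun w => (neg U w)%:E).
Proof. by apply/funext => w; rewrite funenegE/= EFin_max. Qed.

(** The positive and negative parts of [U] have equal integrals over every event generated by [h],
    hence also after multiplication by any nonnegative measurable function of [h]. Taking the two
    parts of [h] as that function, the positive part [U+ h+ + U- h-] and the negative part
    [U- h+ + U+ h-] of the product have the same integral. *)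
Lemma integral_mul_eq0 U h :
  mu.-integrable setT (EFin \o U) -> measurable_fun setT h ->
  mu.-integrable setT (fun w => (U w * h w)%:E) ->
  (forall B, measurable B -> \int[mu]_(w in h @^-1` B) (U w)%:E = 0) ->
  \int[mu]_w (U w * h w)%:E = 0.
Proof.
move=> iU mh iUh U0.
have mU : measurable_fun setT U by exact/measurable_EFinP/(measurable_int _ iU).
have mB B : measurable B -> measurable (h @^-1` B).
  by move=> ?; rewrite -[X in measurable X]setTI; exact: mh.
have posneg B : measurable B ->
    \int[mu]_(w in h @^-1` B) (pos U w)%:E = \int[mu]_(w in h @^-1` B) (neg U w)%:E.
  move=> /[dup] /mB mhB /U0.
  have iUB : mu.-integrable (h @^-1` B) (EFin \o U) by exact: integrableS iU.
  rewrite -[X in X = _ -> _]/(\int[mu]_(w in h @^-1` B) (EFin \o U) w).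
  rewrite integralE funepos_pos funeneg_neg => /eqP.
  rewrite sube_eq ?add0e; first by move/eqP.
  - by rewrite -funepos_pos; exact: integrable_pos_fin_num.
  - by rewrite fin_num_adde_defl// -funeneg_neg; exact: integrable_neg_fin_num.
have key (k : R -> R) : measurable_fun setT k -> (forall x, 0 <= k x)%R ->
    \int[mu]_w (pos U w * k (h w))%:E = \int[mu]_w (neg U w * k (h w))%:E.
  move=> mk k0; apply: ge0_integral_mul_eq => //.
  - exact: measurable_pos.
  - exact: measurable_neg.
  - exact: measurableT_comp.
  - move=> B mB'; rewrite (_ : _ @^-1` _ = h @^-1` (k @^-1` B))//.
    by apply: posneg; rewrite -[X in measurable X]setTI; exact: mk.
have split (a b : T -> R) (k l : R -> R) : measurable_fun setT a ->
    measurable_fun setT b -> (forall w, 0 <= a w)%R -> (forall w, 0 <= b w)%R ->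
    measurable_fun setT k -> measurable_fun setT l ->
    (forall x, 0 <= k x)%R -> (forall x, 0 <= l x)%R ->
    \int[mu]_w (a w * k (h w) + b w * l (h w))%:E =
    \int[mu]_w (a w * k (h w))%:E + \int[mu]_w (b w * l (h w))%:E.
  move=> ma mb a0 b0 mk ml k0 l0.
  under eq_integral do rewrite EFinD.
  rewrite ge0_integralD//.
  - by move=> w _; rewrite lee_fin mulr_ge0.
  - apply/measurable_EFinP/measurable_funM => //; exact: measurableT_comp.
  - by move=> w _; rewrite lee_fin mulr_ge0.
  - apply/measurable_EFinP/measurable_funM => //; exact: measurableT_comp.
pose p (x : R) := Num.max x 0%R; pose q (x : R) := Num.max (- x)%R 0%R.
have mp : measurable_fun setT p by exact: measurable_maxr.
have mq : measurable_fun setT q.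
  by apply: measurable_maxr => //; exact: measurableT_comp.
have p0 x : (0 <= p x)%R by rewrite le_max lexx orbT.
have q0 x : (0 <= q x)%R by rewrite le_max lexx orbT.
rewrite -[LHS]/(\int[mu]_w (EFin \o (fun w => (U w * h w)%R)) w).
rewrite integralE; set x := (X in X - _); set y := (X in _ - X).
suff xy : x = y.
  by rewrite -xy subee// /x; exact: integrable_pos_fin_num.
have -> : x = \int[mu]_w (pos U w * p (h w) + neg U w * q (h w))%:E.
  by apply: eq_integral => w _; rewrite funepos_pos /pos max0M.
have -> : y = \int[mu]_w (neg U w * p (h w) + pos U w * q (h w))%:E.
  apply: eq_integral => w _; rewrite funeneg_neg /neg -mulNr max0M.
  by rewrite opprK.
by rewrite !split//= ?key//; [exact: measurable_neg|exact: measurable_pos|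
  exact: measurable_pos|exact: measurable_neg].
Qed.

End integral_mul_eq0.

Section independence.
Local Open Scope ereal_scope.
Context d (T : measurableType d) (R : realType) (P : probability T R).
Implicit Types U V : T -> R.

(** [integral_mul_eq0] is used twice. With [h = V] it reduces the claim to the vanishing of the
    integral of [U] over [A = V^-1(B)]. As [U] is centered, [\1_A] may be replaced there by
    [\1_A - P A], and the second use has [h = U]. *)
Lemma expectation_indep_mul_eq0 U V :
  P.-integrable setT (EFin \o U) -> measurable_fun setT V ->
  P.-integrable setT (fun w => (U w * V w)%:E) ->
  (forall A B : set R, measurable A -> measurable B ->
     P (U @^-1` A `&` V @^-1` B) = P (U @^-1` A) * P (V @^-1` B)) ->
  \int[P]_w (U w)%:E = 0 ->
  \int[P]_w (U w * V w)%:E = 0.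
Proof.
move=> iU mV iUV indepUV U0.
have mU : measurable_fun setT U by exact/measurable_EFinP/(measurable_int _ iU).
have mpre (f : T -> R) B : measurable_fun setT f -> measurable B ->
    measurable (f @^-1` B).
  by move=> mf mB; rewrite -[X in measurable X]setTI; exact: mf.
apply: integral_mul_eq0 => // B mB.
pose A := V @^-1` B; have mA : measurable A by exact: mpre.
pose c := fine (P A).
have cE : P A = c%:E by rewrite fineK// fin_num_measure.
have iA : P.-integrable setT (fun w => (\1_A w * U w)%:E).
  apply: le_integrable iU => //=.
    by apply/measurable_EFinP/measurable_funM.
  move=> w _; rewrite lee_fin normrM ler_piMl// indicE.
  by case: (_ \in _); rewrite ?normr1 ?normr0.
have icU : P.-integrable setT (fun w => (c * U w)%:E).
  by under eq_fun do rewrite EFinM; exact: integrableZl.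
(* By independence [\1_A - P A] integrates to 0 over every event generated by
   [U]. *)
have : \int[P]_w ((\1_A w - c) * U w)%:E = 0.
  apply: integral_mul_eq0 => //.
  - rewrite (_ : _ \o _ = (EFin \o \1_A) \- (EFin \o cst c)); last first.
      by apply/funext => w /=; rewrite EFinB.
    apply: integrableB => //; first exact: integrable_indic.
    exact: finite_measure_integrable_cst.
  - under eq_fun do rewrite mulrBl EFinB.
    exact: integrableB.
  - move=> C mC; under eq_integral do rewrite EFinB.
    have mUC : measurable (U @^-1` C) by exact: mpre.
    rewrite integralB_EFin//; last 2 first.
    + exact/(integrableS measurableT)/integrable_indic.
    + exact: finite_measure_integrable_cst.
    rewrite integral_indic// (integral_cst _ mUC c%:E).
    rewrite [X in X - _](_ : _ = P (U @^-1` C) * c%:E); last first.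
      by rewrite -cE -indepUV// setIC.
    by rewrite muleC subee// fin_numM// fin_num_measure.
under [X in X = _ -> _]eq_integral do rewrite mulrBl EFinB.
rewrite integralB_EFin//.
have -> : \int[P]_w (c * U w)%:E = 0.
  under eq_integral do rewrite EFinM.
  by rewrite integralZl// U0 mule0.
rewrite sube0 => <-.
rewrite integral_mkcond; apply: eq_integral => w _.
rewrite patchE indicE; case: ifP => _; first by rewrite mul1r.
by rewrite mul0r.
Qed.

End independence.

(** * Second moments *)

Section moments.
Local Open Scope ereal_scope.
Context d (T : measurableType d) (R : realType) (P : probability T R).

Lemma integrable_mul_sqr (f g : T -> R) :
  measurable_fun setT f -> measurable_fun setT g ->
  \int[P]_w (f w ^+ 2)%:E < +oo -> \int[P]_w (g w ^+ 2)%:E < +oo ->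
  P.-integrable setT (fun w => (f w * g w)%:E).
Proof.
move=> mf mg f2 g2.
have isqr (h : T -> R) : measurable_fun setT h ->
    \int[P]_w (h w ^+ 2)%:E < +oo -> P.-integrable setT (fun w => (h w ^+ 2)%:E).
  move=> mh h2; apply/integrableP; split.
    exact/measurable_EFinP/measurable_funX.
  by under eq_integral do rewrite gee0_abs ?lee_fin ?sqr_ge0//.
apply: le_integrable (integrableD measurableT (isqr f mf f2) (isqr g mg g2)) => //.
  exact/measurable_EFinP/measurable_funM.
move=> w _; rewrite /= !lee_fin [leRHS]ger0_norm ?addr_ge0 ?sqr_ge0//.
rewrite normrM -(real_normK (num_real (f w))) -(real_normK (num_real (g w))).
by move: (normr_ge0 (f w)) (normr_ge0 (g w)) => ? ?; nra.
Qed.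

Lemma integrable_of_sqr (f : T -> R) : measurable_fun setT f ->
  \int[P]_w (f w ^+ 2)%:E < +oo -> P.-integrable setT (EFin \o f).
Proof.
move=> mf f2; rewrite (_ : _ \o _ = (fun w => (f w * 1)%:E)); last first.
  by apply/funext => w /=; rewrite mulr1.
apply: (integrable_mul_sqr mf) => //.
under eq_integral do rewrite expr1n.
exact/integrable_lty/(finite_measure_integrable_cst _ 1%R).
Qed.

Lemma second_moment_sum_le n (V : 'I_n -> T -> R) (c : R) :
  (forall i, measurable_fun setT (V i)) ->
  (forall i, \int[P]_w (V i w ^+ 2)%:E <= c%:E) ->
  (forall i l, i != l -> \int[P]_w (V i w * V l w)%:E = 0) ->
  \int[P]_w ((\sum_i V i w) ^+ 2)%:E <= (n%:R * c)%:E.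
Proof.
move=> mV V2 VV.
have iV i l : P.-integrable setT (fun w => (V i w * V l w)%:E).
  by apply: integrable_mul_sqr => //; apply: le_lt_trans (V2 _) (ltry _).
have -> : \int[P]_w ((\sum_i V i w) ^+ 2)%:E =
    \sum_i \sum_l \int[P]_w (V i w * V l w)%:E.
  under eq_integral => w _.
    rewrite expr2 mulr_suml -sumEFin.
    under eq_bigr do rewrite mulr_sumr -sumEFin.
    over.
  rewrite integral_sum//; last by move=> i; exact: integrable_sum.
  by apply: eq_bigr => i _; rewrite integral_sum.
apply: (@le_trans _ _ (\sum_(i < n) c%:E)).
  apply: lee_sum => i _; rewrite (bigD1 i)//= big1 ?adde0; last first.
    by move=> l li; rewrite VV// eq_sym.
  by under eq_integral do rewrite -expr2.
by rewrite sumEFin sumr_const card_ord mulr_natl.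
Qed.

Lemma markov_gt (f : T -> R) (t c : R) : (0 < t)%R ->
  measurable_fun setT f -> (forall w, 0 <= f w)%R ->
  \int[P]_w (f w)%:E <= c%:E -> P [set w | (t < f w)%R] <= (c / t)%:E.
Proof.
move=> t0 mf f0 fc.
have mA : measurable [set w | (t < f w)%R].
  rewrite (_ : [set w | _] = f @^-1` `]t, +oo[); last first.
    by apply/seteqP; split => w /=; rewrite in_itv/= andbT.
  by rewrite -[X in measurable X]setTI; exact: mf.
rewrite EFinM lee_pdivlMr// muleC.
apply: le_trans fc.
rewrite -(integral_cst _ mA t%:E).
apply: (@le_trans _ _ (\int[P]_(w in [set w | (t < f w)%R]) (f w)%:E)).
  apply: ge0_le_integral => //.
  - by move=> w _; rewrite lee_fin ltW.
  - exact/measurable_funTS/measurable_EFinP.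
  - by move=> w /=; rewrite lee_fin => /ltW.
apply: ge0_subset_integral => //.
  exact/measurable_EFinP.
by move=> w _; rewrite lee_fin.
Qed.

End moments.

(** * Sums over an independent, identically distributed sample *)

Section random_sample.
Local Open Scope ereal_scope.
Context d (T : measurableType d) (R : realType) (P : probability T R).
Context d' (E : measurableType d').

Lemma mutually_independent_pair (I : finType) (Z : I -> T -> E) (i l : I)
    (A B : set E) : mutually_independent P Z -> i != l ->
  measurable A -> measurable B ->
  P (Z i @^-1` A `&` Z l @^-1` B) =
    (fine (P (Z i @^-1` A)) * fine (P (Z l @^-1` B)))%:E.
Proof.
move=> indep il mA mB.
have := indep [set i; l]%SET (fun m => if m == i then A else B).
rewrite big_setU1/= ?inE// big_set1 eqxx eq_sym (negbTE il) => <-; last first.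
  by move=> m _; case: ifP.
congr (P _); apply/seteqP; split => w /=.
  move=> [wA wB] m /=; rewrite !inE => /orP[|] /eqP ->; first by rewrite eqxx.
  by rewrite eq_sym (negbTE il).
move=> H; split.
  by have := H i; rewrite /= !inE eqxx; exact.
by have := H l; rewrite /= !inE eqxx orbT eq_sym (negbTE il); exact.
Qed.

Lemma second_moment_indep_sum n (Z : 'I_n -> T -> E) (phi : E -> R) (c : R) :
  mutually_independent P Z -> (forall i, measurable_fun setT (Z i)) ->
  measurable_fun setT phi ->
  (forall i, \int[P]_w (phi (Z i w) ^+ 2)%:E <= c%:E) ->
  (forall i, \int[P]_w (phi (Z i w))%:E = 0) ->
  \int[P]_w ((\sum_i phi (Z i w)) ^+ 2)%:E <= (n%:R * c)%:E.
Proof.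
move=> indep mZ mphi phi2 phi0.
have mphiZ i : measurable_fun setT (phi \o Z i) by exact: measurableT_comp.
have phi2y i : \int[P]_w (phi (Z i w) ^+ 2)%:E < +oo.
  by apply: le_lt_trans (phi2 _) (ltry _).
have mpre B : measurable B -> measurable (phi @^-1` B).
  by move=> mB; rewrite -[X in measurable X]setTI; exact: mphi.
have mZpre i B : measurable B -> measurable (Z i @^-1` B).
  by move=> mB; rewrite -[X in measurable X]setTI; exact: mZ.
apply: (@second_moment_sum_le _ _ _ _ _ (fun i w => phi (Z i w))) => // i l il.
apply: expectation_indep_mul_eq0 => //.
- exact: (integrable_of_sqr (mphiZ i) (phi2y i)).
- exact: (mphiZ l).
- exact: (integrable_mul_sqr (mphiZ i) (mphiZ l) (phi2y i) (phi2y l)).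
- move=> A B mA mB.
  have := mutually_independent_pair indep il (mpre _ mA) (mpre _ mB).
  rewrite EFinM !fineK ?fin_num_measure//; exact/mZpre/mpre.
Qed.

Lemma ge0_expectation_same_distribution (Z Z' : T -> E) (f : E -> \bar R) :
  measurable_fun setT Z -> measurable_fun setT Z' ->
  same_distribution P Z Z' -> measurable_fun setT f -> (forall x, 0 <= f x) ->
  \int[P]_w f (Z w) = \int[P]_w f (Z' w).
Proof.
move=> mZ mZ' ZZ' mf f0.
rewrite -[LHS](@ge0_integral_pushforward _ _ _ _ _ _ mZ P setT f)//.
rewrite -[RHS](@ge0_integral_pushforward _ _ _ _ _ _ mZ' P setT f)//.
by apply: eq_measure_integral => A mA _; exact: ZZ'.
Qed.

Lemma expectation_same_distribution (Z Z' : T -> E) (f : E -> \bar R) :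
  measurable_fun setT Z -> measurable_fun setT Z' ->
  same_distribution P Z Z' -> measurable_fun setT f ->
  \int[P]_w f (Z w) = \int[P]_w f (Z' w).
Proof.
move=> mZ mZ' ZZ' mf.
rewrite -[LHS]/(\int[P]_w (f \o Z) w) -[RHS]/(\int[P]_w (f \o Z') w).
rewrite integralE [RHS]integralE.
rewrite (funepos_comp f Z) (funeneg_comp f Z).
rewrite (funepos_comp f Z') (funeneg_comp f Z').
congr (_ - _); apply: ge0_expectation_same_distribution => //.
- exact: measurable_funepos.
- exact: measurable_funeneg.
Qed.

End random_sample.

(** * Consequences of the conditional mean and variance of the error *)

Section conditional_moments.
Local Open Scope ereal_scope.
Context d (T : measurableType d) (R : realType) (P : probability T R).
Context d' (E : measurableType d') (Z : T -> E) (mZ : measurable_fun setT Z).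
Notation G := (generated_sigma_algebra Z).

Let generated_comp (g : E -> R) B : measurable_fun setT g -> measurable B ->
  G ((g \o Z) @^-1` B).
Proof.
move=> mg mB; exists (g @^-1` B); last by rewrite setTI.
by rewrite -[X in measurable X]setTI; exact: mg.
Qed.

Lemma cond_expectation0_mul (V : T -> R) (g : E -> R) :
  is_cond_expectation P G V (fun=> 0%R) -> measurable_fun setT g ->
  P.-integrable setT (fun w => (V w * g (Z w))%:E) ->
  \int[P]_w (V w * g (Z w))%:E = 0.
Proof.
move=> [iV _ _ V0] mg iVg; apply: integral_mul_eq0 => //.
  exact: measurableT_comp.
by move=> B mB; rewrite V0 ?integral0//; exact: generated_comp.
Qed.

(** [is_cond_variance] centers at some unspecified version of the conditional mean; this identifies
    that version with 0 almost everywhere when the conditional mean is 0. *)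
Lemma cond_expectation0_ae (M : T -> R) :
  P.-integrable setT (EFin \o M) ->
  (forall B : set R, measurable B -> G (M @^-1` B)) ->
  (forall A, G A -> \int[P]_(w in A) (M w)%:E = 0) ->
  ae_eq P setT (EFin \o M) (cst 0).
Proof.
move=> iM GM M0.
have mM : measurable_fun setT M by exact/measurable_EFinP/(measurable_int _ iM).
(* [M * clip M] is nonnegative and vanishes only where [M] does; boundedness of
   [clip] keeps it integrable. *)
pose clip (x : R) : R := (Num.max (Num.min x 1) (-1))%R.
have mclip : measurable_fun setT clip.
  by apply: measurable_maxr => //; exact: measurable_minr.
have mcM : measurable_fun setT (fun w => M w * clip (M w))%R.
  by apply: measurable_funM => //; exact: measurableT_comp.
have clipM x : (0 <= x * clip x <= `|x|)%R.
  rewrite /clip /Num.max /Num.min.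
  by case: (ger0P x) => x0; case: (ltP x 1%R) => x1; case: ltP => x2;
    apply/andP; split; nra.
have clip_eq0 x : (x * clip x = 0 -> x = 0)%R.
  rewrite /clip /Num.max /Num.min => /eqP; rewrite mulf_eq0 => /orP[/eqP//|].
  by case: (ltP x 1%R) => x1; case: ltP => x2 /eqP; lra.
have clip_int0 : \int[P]_w `|(M w * clip (M w))%:E| = 0.
  under eq_integral do rewrite gee0_abs ?lee_fin ?(andP (clipM _)).1//.
  apply: integral_mul_eq0 => //.
  - exact: measurableT_comp.
  - apply: le_integrable iM => //=; first exact/measurable_EFinP.
    by move=> w _; have /andP[c0 c1] := clipM (M w); rewrite lee_fin ger0_norm.
  - move=> B mB; apply: M0; rewrite (_ : _ @^-1` B = M @^-1` (clip @^-1` B))//.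
    by apply: GM; rewrite -[X in measurable X]setTI; exact: mclip.
have mcME : measurable_fun setT (fun w => (M w * clip (M w))%:E).
  exact/measurable_EFinP.
have H := (ae_eq_integral_abs P measurableT mcME).1 clip_int0.
apply: filterS H => w /= /(_ I) [/clip_eq0 Mw0] _; by rewrite Mw0.
Qed.

(** The squared function [g(Z)^2] is pulled out of the conditional expectation, once [V] has been
    replaced by [V - M] almost everywhere. The nonnegative form [ge0_integral_mul_eq] fits here: the
    identity serves to show that the left side is finite, so integrability cannot be presupposed. *)
Lemma cond_variance_mul (V : T -> R) (s : R) (g : E -> R) :
  is_cond_expectation P G V (fun=> 0%R) ->
  is_cond_variance P G V (fun=> s) -> (0 <= s)%R ->
  measurable_fun setT g ->
  \int[P]_w ((V w * g (Z w)) ^+ 2)%:E = \int[P]_w (s * g (Z w) ^+ 2)%:E.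
Proof.
move=> [iV _ _ V0] [M [[_ iM GM VM] [_ _ _ Vs]]] s0 mg.
have mV : measurable_fun setT V by exact/measurable_EFinP/(measurable_int _ iV).
have mM : measurable_fun setT M by exact/measurable_EFinP/(measurable_int _ iM).
have mgZ : measurable_fun setT (fun w => g (Z w)) by exact: measurableT_comp.
have mgZ2 : measurable_fun setT (fun w => g (Z w) ^+ 2)%R by exact: measurable_funX.
have M0 : ae_eq P setT (EFin \o M) (cst 0).
  apply: cond_expectation0_ae => // A GA.
  by rewrite -VM// V0// integral0.
transitivity (\int[P]_w ((V w - M w) ^+ 2 * g (Z w) ^+ 2)%:E).
  apply: ae_eq_integral => //.
  - by apply/measurable_EFinP/measurable_funX/measurable_funM.
  - apply/measurable_EFinP/measurable_funM => //.
    exact/measurable_funX/measurable_funB.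
  - by apply: filterS M0 => w /= /(_ I) [->] _; rewrite subr0 exprMn.
apply: ge0_integral_mul_eq => //.
- exact/measurable_funX/measurable_funB.
- by move=> w; exact: sqr_ge0.
- by move=> w; exact: sqr_ge0.
- move=> B mB; apply: Vs.
  apply: (generated_comp (g := fun x => g x ^+ 2)%R) => //.
  exact: measurable_funX.
Qed.

End conditional_moments.

Section more_moments.
Local Open Scope ereal_scope.
Context d (T : measurableType d) (R : realType) (P : probability T R).

(** Expanding the square leaves [E[f^2] - m^2]. The center is written with [fine] to match the
    entries of [second_moment_mx]. *)
Lemma centered_second_moment_le (f : T -> R) (c : R) : measurable_fun setT f ->
  \int[P]_w (f w ^+ 2)%:E <= c%:E ->
  \int[P]_w ((f w - fine (\int[P]_w (f w)%:E)) ^+ 2)%:E <= c%:E.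
Proof.
move=> mf f2; set m := fine _.
have f2y : \int[P]_w (f w ^+ 2)%:E < +oo.
  exact: le_lt_trans f2 (ltry _).
have if1 : P.-integrable setT (EFin \o f) by exact: integrable_of_sqr.
have if2 : P.-integrable setT (fun w => (f w ^+ 2)%:E).
  by under eq_fun do rewrite expr2; exact: integrable_mul_sqr.
have mE : \int[P]_w (f w)%:E = m%:E by rewrite fineK// integrable_fin_num.
have iZ : P.-integrable setT (fun w => ((- 2 * m) * f w)%:E).
  by under eq_fun do rewrite EFinM; exact: integrableZl.
have icst : P.-integrable setT (fun=> (m ^+ 2)%:E).
  exact: (finite_measure_integrable_cst _ (m ^+ 2)%R).
have -> : \int[P]_w ((f w - m) ^+ 2)%:E =
    \int[P]_w (((f w ^+ 2)%:E + ((- 2 * m) * f w)%:E) + (m ^+ 2)%:E).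
  by apply: eq_integral => w _; rewrite -!EFinD; congr EFin; ring.
rewrite integralD//; last exact: integrableD.
rewrite integralD//.
have -> : \int[P]_w ((- 2 * m) * f w)%:E = (- 2 * m * m)%:E.
  by under eq_integral do rewrite EFinM; rewrite integralZl// mE.
rewrite (@integral_cst _ _ _ P _ measurableT (m ^+ 2)%:E).
rewrite [X in _ * X](_ : _ = 1) ?mule1; last exact: probability_setT.
rewrite -addeA -EFinD (_ : _ + _ = - (m ^+ 2))%R; last by ring.
apply: le_trans f2; rewrite -[leRHS]adde0 leeD2l// lee_fin.
by rewrite oppr_le0 sqr_ge0.
Qed.

End more_moments.

(** * Deviation of the sample moments *)

Section fourth_moments.
Local Open Scope ereal_scope.
Context d (T : measurableType d) (R : realType) (P : probability T R).

Lemma second_moment_le_fourth (f : T -> R) (c : R) : measurable_fun setT f ->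
  \int[P]_w (f w ^+ 4)%:E <= c%:E -> \int[P]_w (f w ^+ 2)%:E <= (1 + c)%:E.
Proof.
move=> mf f4.
apply: (@le_trans _ _ (\int[P]_w (1%:E + (f w ^+ 4)%:E))).
  apply: ge0_le_integral => //.
  - by move=> w _; rewrite lee_fin sqr_ge0.
  - exact/measurable_EFinP/measurable_funX.
  - apply: emeasurable_funD => //; exact/measurable_EFinP/measurable_funX.
  - move=> w _; rewrite -EFinD lee_fin; have := sqr_ge0 (f w ^+ 2 - 1)%R.
    by have := sqr_ge0 (f w); nra.
rewrite ge0_integralD//; last 2 first.
- by move=> w _; rewrite lee_fin (_ : 4 = 2 * 2)%N// exprM sqr_ge0.
- exact/measurable_EFinP/measurable_funX.
rewrite (@integral_cst _ _ _ P _ measurableT 1%:E) mul1e EFinD.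
rewrite [X in X + _](_ : _ = 1) ?leeD2l//; exact: probability_setT.
Qed.

(** Pointwise [(f g)^2 <= f^4 + g^4]; this is the origin of [2 * M4] in the Gram bound. *)
Lemma second_moment_mul_le (f g : T -> R) (c : R) :
  measurable_fun setT f -> measurable_fun setT g ->
  \int[P]_w (f w ^+ 4)%:E <= c%:E -> \int[P]_w (g w ^+ 4)%:E <= c%:E ->
  \int[P]_w ((f w * g w) ^+ 2)%:E <= (2 * c)%:E.
Proof.
move=> mf mg f4 g4.
have ge0_4 (x : R) : (0 <= x ^+ 4)%R by rewrite (_ : 4 = 2 * 2)%N// exprM sqr_ge0.
apply: (@le_trans _ _ (\int[P]_w ((f w ^+ 4)%:E + (g w ^+ 4)%:E))).
  apply: ge0_le_integral => //.
  - by move=> w _; rewrite lee_fin sqr_ge0.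
  - exact/measurable_EFinP/measurable_funX/measurable_funM.
  - by apply: emeasurable_funD => //; exact/measurable_EFinP/measurable_funX.
  - move=> w _; rewrite -EFinD lee_fin exprMn.
    have -> : (f w ^+ 4 = (f w ^+ 2) ^+ 2)%R by rewrite -exprM.
    have -> : (g w ^+ 4 = (g w ^+ 2) ^+ 2)%R by rewrite -exprM.
    by move: (sqr_ge0 (f w)) (sqr_ge0 (g w)); nra.
rewrite ge0_integralD//;
  [|by move=> w _; rewrite lee_fin|exact/measurable_EFinP/measurable_funX
  |by move=> w _; rewrite lee_fin|exact/measurable_EFinP/measurable_funX].
by rewrite mulr2n mulrDl mul1r EFinD leeD.
Qed.

End fourth_moments.

Section deviation.
Local Open Scope ereal_scope.
Context d (T : measurableType d) (R : realType) (P : probability T R).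
Context (n p : nat) (M4 sigma : R).
Context (X : 'I_n -> {RV P >-> (p.-tuple R)%type}) (eps : 'I_n -> {RV P >-> R}).
Context (X0 : {RV P >-> (p.-tuple R)%type}) (eps0 : {RV P >-> R}).
Hypothesis M4_ge : forall j : 'I_p, \int[P]_w (tnth (X0 w) j ^+ 4)%:E <= M4%:E.
Hypothesis indep : mutually_independent P (fun i w => (X i w, eps i w)).
Hypothesis ident : forall i, same_distribution P
  (fun w => (X i w, eps i w)) (fun w => (X0 w, eps0 w)).

Let Z i w := (X i w, eps i w).
Let Z0 w := (X0 w, eps0 w).

Let mZ i : measurable_fun setT (Z i).
Proof. exact: measurable_fun_pair. Qed.

Let mZ0 : measurable_fun setT Z0.
Proof. exact: measurable_fun_pair. Qed.

Let mtnth (j : 'I_p) :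
  measurable_fun setT (fun z : p.-tuple R * R => tnth z.1 j).
Proof. exact: (measurableT_comp (@measurable_tnth _ _ _ j)). Qed.

Let mX0 (j : 'I_p) : measurable_fun setT (fun w => tnth (X0 w) j).
Proof. exact: (measurableT_comp (mtnth j) mZ0). Qed.

(** A single function [phi] of the pair covers both Gram entries and score coordinates, and its
    moments have to be checked on the generic pair only. *)
Let second_moment_sample_sum (phi : p.-tuple R * R -> R) (c : R) :
  measurable_fun setT phi ->
  \int[P]_w (phi (Z0 w) ^+ 2)%:E <= c%:E -> \int[P]_w (phi (Z0 w))%:E = 0 ->
  \int[P]_w ((\sum_i phi (Z i w)) ^+ 2)%:E <= (n%:R * c)%:E.
Proof.
move=> mphi phi2 phi0; apply: second_moment_indep_sum => // i.
- rewrite (ge0_expectation_same_distribution (mZ i) mZ0 (ident i)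
    (f := fun z => (phi z ^+ 2)%:E))//.
  + exact/measurable_EFinP/measurable_funX.
  + by move=> z; rewrite lee_fin sqr_ge0.
- rewrite (expectation_same_distribution (mZ i) mZ0 (ident i)
    (f := fun z => (phi z)%:E))//.
  exact/measurable_EFinP.
Qed.

(** Each of the [p^2] entries is a sum of [n] orthogonal centered terms whose variance is at most
    the second moment of a product of two coordinates. *)
Lemma gram_deviation_moment :
  \int[P]_w (\sum_j \sum_l (\sum_i (tnth (X i w) j * tnth (X i w) l
     - second_moment_mx P X0 j l)) ^+ 2)%:E <= (p%:R ^+ 2 * (n%:R * (2 * M4)))%:E.
Proof.
have mg (j l : 'I_p) : measurable_fun setT
    (fun z : p.-tuple R * R => tnth z.1 j * tnth z.1 l - second_moment_mx P X0 j l)%R.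
  by apply: measurable_funB => //; exact: measurable_funM.
have ms j l : measurable_fun setT (fun w => ((\sum_i (tnth (X i w) j *
    tnth (X i w) l - second_moment_mx P X0 j l)) ^+ 2)%:E).
  apply/measurable_EFinP/measurable_funX/measurable_sum => i.
  exact: (measurableT_comp (mg j l) (mZ i)).
under eq_integral => w _.
  rewrite -sumEFin; under eq_bigr do rewrite -sumEFin; over.
rewrite ge0_integral_sum//; last 2 first.
- by move=> j; exact: emeasurable_sum.
- by move=> j w _; apply: sume_ge0 => l _; rewrite lee_fin sqr_ge0.
apply: (@le_trans _ _ (\sum_(j < p) \sum_(l < p) (n%:R * (2 * M4))%:E)).
  apply: lee_sum => j _; rewrite ge0_integral_sum//; last first.
    by move=> l w _; rewrite lee_fin sqr_ge0.
  apply: lee_sum => l _.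
  apply: (second_moment_sample_sum (mg j l)) => /=.
  - rewrite mxE unlock; apply: centered_second_moment_le.
      exact: measurable_funM.
    exact: second_moment_mul_le.
  - rewrite mxE unlock.
    (* Integrability makes [fine] lossless, so that subtracting the matrix entry really centers the
       product. *)
    have iXX : P.-integrable setT (fun w => (tnth (X0 w) j * tnth (X0 w) l)%:E).
      by apply: integrable_mul_sqr => //;
        apply: le_lt_trans (second_moment_le_fourth _ (M4_ge _)) (ltry _).
    under eq_integral do rewrite EFinB.
    rewrite integralB_EFin//; last exact: finite_measure_integrable_cst.
    rewrite (@integral_cst _ _ _ P _ measurableT (fine _)%:E).
    rewrite [X in _ * X](_ : _ = 1) ?mule1; last exact: probability_setT.
    by rewrite fineK ?subee// integrable_fin_num.
under eq_bigr do rewrite sumEFin sumr_const card_ord.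
by rewrite sumEFin sumr_const card_ord -mulrnA -[X in X%:E <= _]mulr_natl natrM expr2.
Qed.

(** Conditioning on the covariates gives [E[(eps X_j)^2] = sigma^2 E[X_j^2]], and [x^2 <= 1 + x^4]
    accounts for the factor [1 + M4]. *)
Lemma score_moment :
  is_cond_expectation P (generated_sigma_algebra X0) eps0 (fun=> 0%R) ->
  is_cond_variance P (generated_sigma_algebra X0) eps0 (fun=> (sigma ^+ 2)%R) ->
  \int[P]_w (\sum_j (\sum_i tnth (X i w) j * eps i w) ^+ 2)%:E <=
    (p%:R * (n%:R * (sigma ^+ 2 * (1 + M4))))%:E.
Proof.
move=> eps_mean eps_var.
have mg (j : 'I_p) : measurable_fun setT
    (fun z : p.-tuple R * R => tnth z.1 j * z.2)%R.
  by apply: measurable_funM.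
under eq_integral => w _ do rewrite -sumEFin.
rewrite ge0_integral_sum//; last 2 first.
- move=> j; apply/measurable_EFinP/measurable_funX/measurable_sum => i.
  exact: (measurableT_comp (mg j) (mZ i)).
- by move=> j w _; rewrite lee_fin sqr_ge0.
apply: (@le_trans _ _ (\sum_(j < p) (n%:R * (sigma ^+ 2 * (1 + M4)))%:E)).
  apply: lee_sum => j _.
  have X2 := second_moment_le_fourth (mX0 j) (M4_ge j).
  have eX2 : \int[P]_w ((eps0 w * tnth (X0 w) j) ^+ 2)%:E <=
      (sigma ^+ 2 * (1 + M4))%:E.
    rewrite (cond_variance_mul (measurable_funPT X0) eps_mean eps_var
      (sqr_ge0 _) (measurable_tnth j)).
    under eq_integral do rewrite EFinM.
    rewrite ge0_integralZl_EFin ?sqr_ge0//; last 2 first.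
    - by move=> w _; rewrite lee_fin sqr_ge0.
    - exact/measurable_EFinP/measurable_funX.
    by rewrite [X in _ <= X]EFinM lee_wpmul2l// lee_fin sqr_ge0.
  have eXm : measurable_fun setT (fun w => (eps0 w * tnth (X0 w) j)%R).
    exact: measurable_funM.
  apply: (second_moment_sample_sum (mg j)) => /=.
  - by under eq_integral do rewrite mulrC.
  - under eq_integral do rewrite mulrC.
    apply: (cond_expectation0_mul (measurable_funPT X0) eps_mean (measurable_tnth j)).
    exact: (integrable_of_sqr eXm (le_lt_trans eX2 (ltry _))).
by rewrite sumEFin sumr_const card_ord -[X in X%:E <= _]mulr_natl.
Qed.

End deviation.

(** * Probability of a large estimation error at a fixed sample size *)

Section probability_bound.
Context d (T : measurableType d) (R : realType) (P : probability T R).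
Context (n p k : nat) (a sigma M4 lambda rho : R) (beta : 'cV[R]_p).
Context (X : 'I_n -> {RV P >-> (p.-tuple R)%type}) (eps : 'I_n -> {RV P >-> R}).
Context (X0 : {RV P >-> (p.-tuple R)%type}) (eps0 : {RV P >-> R}).
Context (betahat : T -> 'cV[R]_p).

(** Markov's inequality at the two thresholds of [ls_scad_error]: [8 = 2 * 2^2] comes from
    [(n rho / 2)^2], and [64 / e^2] from [(n rho e / 8)^2]. The score term is enlarged by [p <= p^2]
    to share the common rate. The absolute value of [M4] keeps the coefficient nonnegative even for
    [p = 0], where the moment bound says nothing about the sign of [M4]. *)
Lemma ls_scad_probability_bound (e : R) : (0 < n)%N -> (2 < a) ->
  (0 < lambda) -> (k <= p)%N -> (0 < rho) -> (0 < e) ->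
  (forall j : 'I_p, (k <= j)%N -> beta j 0 = 0) ->
  (forall j, measurable_fun setT (fun w => betahat w j 0)) ->
  (forall w,
    ls_scad lambda a (design_mx X w *m beta + \col_i eps i w)
      (design_mx X w) (betahat w) <=
    ls_scad lambda a (design_mx X w *m beta + \col_i eps i w)
      (design_mx X w) beta) ->
  (forall j : 'I_p, (\int[P]_w (tnth (X0 w) j ^+ 4)%:E <= M4%:E)%E) ->
  mutually_independent P (fun i w => (X i w, eps i w)) ->
  (forall i, same_distribution P
    (fun w => (X i w, eps i w)) (fun w => (X0 w, eps0 w))) ->
  is_cond_expectation P (generated_sigma_algebra X0) eps0 (fun=> 0) ->
  is_cond_variance P (generated_sigma_algebra X0) eps0 (fun=> (sigma ^+ 2)) ->
  is_smallest_eigenvalue (second_moment_mx P X0) rho ->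
  (2 * (a + 1) * (k%:R * lambda ^+ 2 / rho) <= e ^+ 2) ->
  (P [set w | (e < enorm (betahat w - beta))%R] <=
    ((8 * `|M4| + 64 * (sigma ^+ 2 * (1 + `|M4|)) / e ^+ 2) *
     (p%:R ^+ 2 / (n%:R * rho ^+ 2)))%:E)%E.
Proof.
move=> n0 a2 l0 kp rho0 e0 beta0 mbetahat mini M4_ge indep ident emean evar
  rho_min small.
have n0' : (0 < n%:R :> R) by rewrite ltr0n.
pose S := second_moment_mx P X0.
have symS : (S^T = S).
  by apply/matrixP => i j; rewrite !mxE; congr fine; congr expectation;
    apply/funext => w; rewrite mulrC.
pose f1 w : R := (\sum_j \sum_l
  (\sum_i (tnth (X i w) j * tnth (X i w) l - S j l)) ^+ 2).
pose f2 w : R := (\sum_j (\sum_i tnth (X i w) j * eps i w) ^+ 2).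
have mX i (j : 'I_p) : measurable_fun setT (fun w => tnth (X i w) j).
  exact: (measurableT_comp (@measurable_tnth _ _ _ j)).
have mf1 : measurable_fun setT f1.
  apply: measurable_sum => j; apply: measurable_sum => l; apply: measurable_funX.
  apply: measurable_sum => i; apply: measurable_funB => //.
  exact: measurable_funM.
have mf2 : measurable_fun setT f2.
  apply: measurable_sum => j; apply: measurable_funX.
  by apply: measurable_sum => i; exact: measurable_funM.
have mgt (f : T -> R) t : measurable_fun setT f -> measurable [set w | (t < f w)].
  move=> mf; rewrite (_ : [set w | _] = f @^-1` `]t, +oo[).
    by rewrite -[X in measurable X]setTI; exact: mf.
  by apply/seteqP; split => w /=; rewrite in_itv/= andbT.
pose t1 := ((n%:R * rho / 2) ^+ 2); pose t2 := ((n%:R * rho * e / 8) ^+ 2).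
have t1_gt0 : (0 < t1) by rewrite exprn_gt0// !mulr_gt0// invr_gt0.
have t2_gt0 : (0 < t2) by rewrite exprn_gt0// !mulr_gt0// invr_gt0.
(* Monotonicity of [P] asks for a measurable error event; squaring turns the norm into a polynomial
   in the coordinates of [betahat]. *)
have mE : measurable [set w | (e < enorm (betahat w - beta))].
  rewrite (_ : [set w | _] =
      [set w | (e ^+ 2 < \sum_j (betahat w j 0 - beta j 0) ^+ 2)]).
    apply: mgt; apply: measurable_sum => j; apply: measurable_funX.
    exact: measurable_funB.
  have sqrE w : (e < enorm (betahat w - beta) =
      (e ^+ 2 < \sum_j (betahat w j 0 - beta j 0) ^+ 2)).
    rewrite (eq_bigr (fun j => (betahat w - beta) j 0 ^+ 2)); last first.
      by move=> j _; rewrite !mxE.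
    rewrite -enorm_sqr ltr_pXn2r ?nnegrE//; [exact: ltW|exact: sqrtr_ge0].
  by apply/seteqP; split => w /=; rewrite sqrE.
apply: (@le_trans _ _ (P ([set w | (t1 < f1 w)] `|` [set w | (t2 < f2 w)]))).
  apply: le_measure; [exact/mem_set|by apply/mem_set/measurableU; exact: mgt|].
  move=> w /= ew.
  have := ls_scad_error a2 l0 n0 kp beta0 (mini w) rho0 e0
    (smallest_eigenvalue_le symS rho_min) small ew.
  rewrite -/t1 -/t2.
  have -> : (\sum_j \sum_l
      (\sum_i (design_mx X w i j * design_mx X w i l - S j l)) ^+ 2) = f1 w.
    by apply: eq_bigr => j _; apply: eq_bigr => l _; congr (_ ^+ 2);
      apply: eq_bigr => i _; rewrite !mxE.
  have -> // : (\sum_j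
      (\sum_i design_mx X w i j * (\col_i eps i w) i 0) ^+ 2) = f2 w.
  by apply: eq_bigr => j _; congr (_ ^+ 2); apply: eq_bigr => i _; rewrite !mxE.
apply: (le_trans (measureU2 _ (mgt f1 t1 mf1) (mgt f2 t2 mf2))).
have P1 := markov_gt t1_gt0 mf1 _ (gram_deviation_moment M4_ge indep ident).
have P2 := markov_gt t2_gt0 mf2 _ (score_moment M4_ge indep ident emean evar).
apply: (le_trans (leeD (P1 _) (P2 _))).
- by move=> w; apply: sumr_ge0 => j _; apply: sumr_ge0 => l _; exact: sqr_ge0.
- by move=> w; apply: sumr_ge0 => j _; exact: sqr_ge0.
rewrite -EFinD lee_fin [leRHS]mulrDl; apply: lerD.
- rewrite (_ : (_ / t1 = 8 * M4 * (p%:R ^+ 2 / (n%:R * rho ^+ 2)))); last first.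
    by rewrite /t1; field; rewrite !gt_eqF.
  rewrite ler_wpM2r ?ler_pM2l ?ler_norm//.
  by rewrite divr_ge0 ?exprn_ge0// mulr_ge0 ?sqr_ge0// ltW.
- rewrite (_ : (_ / t2 = 64 * (sigma ^+ 2 * (1 + M4)) / e ^+ 2 *
      (p%:R / (n%:R * rho ^+ 2)))); last first.
    by rewrite /t2; field; rewrite !gt_eqF.
  have r0 : (0 <= (n%:R * rho ^+ 2)^-1) by rewrite invr_ge0 mulr_ge0 ?sqr_ge0// ltW.
  have e20 : (0 <= (e ^+ 2)^-1) by rewrite invr_ge0 sqr_ge0.
  have s0 : (0 <= sigma ^+ 2) by exact: sqr_ge0.
  apply: (@le_trans _ _ (64 * (sigma ^+ 2 * (1 + `|M4|)) / e ^+ 2 *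
      (p%:R / (n%:R * rho ^+ 2)))).
    rewrite ler_wpM2r ?mulr_ge0// ler_wpM2r// ler_pM2l// ler_wpM2l//.
    by rewrite lerD2l ler_norm.
  have c0 : 0 <= 64 * (sigma ^+ 2 * (1 + `|M4|)) / e ^+ 2.
    by do 3 apply: mulr_ge0 => //; exact: addr_ge0.
  apply: ler_wpM2l => //; apply: ler_wpM2r => //.
  by rewrite -natrX ler_nat; case: (p) => // q; rewrite expnS expn1 leq_pmulr.
Qed.

End probability_bound.

Theorem theorem2 (R : realType)
  (d : nat -> measure_display) (T : forall n, measurableType (d n))
  (P : forall n, probability (T n) R)
  (p k : nat -> nat) (a sigma M4 : R) (lambda rho1 : nat -> R)
  (beta : forall n, 'cV[R]_(p n))
  (X : forall n, 'I_n -> {RV (P n) >-> ((p n).-tuple R)%type})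
  (eps : forall n, 'I_n -> {RV (P n) >-> R})
  (* (X0 n, eps0 n) is the generic pair for sample size n *)
  (X0 : forall n, {RV (P n) >-> ((p n).-tuple R)%type})
  (eps0 : forall n, {RV (P n) >-> R})
  (Y : forall n, 'I_n -> T n -> R)
  (betahat : forall n, T n -> 'cV[R]_(p n))
  (ha : 2 < a)
  (hlambda : forall n, (0 < n)%N -> 0 < lambda n)
  (hk : forall n, (0 < n)%N -> (k n <= p n)%N)
  (hbeta1 : forall n, (0 < n)%N ->
     forall j : 'I_(p n), (j < k n)%N -> beta n j 0 != 0)
  (hbeta2 : forall n, (0 < n)%N ->
     forall j : 'I_(p n), (k n <= j)%N -> beta n j 0 = 0)
  (hY : forall n (i : 'I_n) (w : T n),
     Y n i w = \sum_(j < p n) tnth (X n i w) j * beta n j 0 + eps n i w)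
  (hbetahat_meas : forall n, (0 < n)%N -> forall (j : 'I_(p n)),
     measurable_fun setT (fun w => betahat n w j 0))
  (hbetahat : forall n, (0 < n)%N -> forall w : T n,
     is_global_minimizer
       (ls_scad (lambda n) a (\col_(i < n) Y n i w) (design_mx (X n) w))
       (betahat n w))
  (hM4 : forall n, (0 < n)%N -> forall j : 'I_(p n),
     ('E_(P n)[fun w => (tnth (X0 n w) j ^+ 4)%R] <= M4%:E)%E)
  (hindep : forall n, (0 < n)%N ->
     mutually_independent (P n) (fun (i : 'I_n) w => (X n i w, eps n i w)))
  (hident : forall n, (0 < n)%N -> forall i : 'I_n,
     same_distribution (P n) (fun w => (X n i w, eps n i w))
                             (fun w => (X0 n w, eps0 n w)))
  (hEX : forall n, (0 < n)%N -> forall (i : 'I_n) (j : 'I_(p n)),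
     ('E_(P n)[fun w => tnth (X n i w) j] = 0)%E)
  (hVX : forall n, (0 < n)%N -> forall (i : 'I_n) (j : 'I_(p n)),
     ('V_(P n)[fun w => tnth (X n i w) j] = 1)%E)
  (hEeps : forall n, (0 < n)%N ->
     is_cond_expectation (P n) (generated_sigma_algebra (X0 n)) (eps0 n)
       (fun=> 0))
  (hVeps : forall n, (0 < n)%N ->
     is_cond_variance (P n) (generated_sigma_algebra (X0 n)) (eps0 n)
       (fun=> sigma ^+ 2))
  (hrho1 : forall n, (0 < n)%N ->
     is_smallest_eigenvalue (second_moment_mx (P n) (X0 n)) (rho1 n))
  (hrho1_gt0 : forall n, (0 < n)%N -> 0 < rho1 n)
  (hii : (p n)%:R ^+ 2 / (n%:R * rho1 n ^+ 2) @[n --> \oo] --> (0 : R))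
  (hiii : (k n)%:R * lambda n ^+ 2 / rho1 n @[n --> \oo] --> (0 : R)) :
  forall e : R, 0 < e ->
    P n [set w | e < enorm (betahat n w - beta n)] @[n --> \oo] --> 0%E.
Proof.
move=> e e0.
(* [K] depends on [e] but not on [n], so condition (ii) sends the bound to 0. *)
pose K := 8 * `|M4| + 64 * (sigma ^+ 2 * (1 + `|M4|)) / e ^+ 2.
pose bound n := K * ((p n)%:R ^+ 2 / (n%:R * rho1 n ^+ 2)).
have bound0 : (bound n)%:E @[n --> \oo] --> 0%E.
  apply: cvg_EFin; first by near=> n.
  rewrite -(mulr0 K); exact: cvgMr hii.
apply: (squeeze_cvge _ (@cvg_cst _ _ _ _ _) bound0).
(* Condition (iii) supplies, for the fixed [e] and all large [n], the smallness that absorbs the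
   penalty term. *)
have small0 : 2 * (a + 1) * ((k n)%:R * lambda n ^+ 2 / rho1 n) @[n --> \oo] --> 0.
  rewrite -(mulr0 (2 * (a + 1))); exact: cvgMr hiii.
near=> n; rewrite measure_ge0/=.
have n0 : (0 < n)%N by near: n; exact: nbhs_infty_gt.
apply: (@ls_scad_probability_bound _ _ _ _ _ _ (k n) a sigma M4 (lambda n) (rho1 n)
  (beta n) (X n) (eps n) (X0 n) (eps0 n) (betahat n) e) => //.
- exact: hlambda.
- exact: hk.
- exact: hrho1_gt0.
- exact: hbeta2.
- exact: hbetahat_meas.
- move=> w; have := hbetahat n n0 w (beta n).
  rewrite (_ : \col_i Y n i w =
    design_mx (X n) w *m beta n + \col_i eps n i w)//.
  apply/colP => i; rewrite !mxE hY; congr (_ + _).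
  by apply: eq_bigr => j _; rewrite mxE.
- by move=> j; have := hM4 n n0 j; rewrite unlock.
- exact: hindep.
- exact: hident.
- exact: hEeps.
- exact: hVeps.
- exact: hrho1.
- apply: ltW; near: n.
  by apply: (cvgr_lt _ small0); rewrite exprn_gt0.
Unshelve. all: by end_near.
Qed.
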